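(* Let $\{a_1,\dots,a_n\}$ and $\{a'_1,\dots,a'_m\}$ be two sets of distinct complex numbers, put $a=(a_1,\dots,a_n)$, $a'=(a'_1,\dots,a'_m)$, and let $\varphi:R_a\to R_{a'}$ be an isomorphism of associative $\mathbb{C}$-algebras. Then $m=n$, $\varphi$ is a fractional linear transformation (i.e. $\varphi$ is the restriction of a $\mathbb{C}$-automorphism of $\mathbb{C}(t)$ with $\varphi(t)=\frac{pt+q}{rt+s}$, $ps-qr\neq0$), and one of the following two cases holds: (a) There exists a constant $c\in\mathbb{C}^*$ such that, after reordering the $a'_i$ if necessary, $a_i-a_1=c(a'_i-a'_1)$ and $\varphi((t-a_i)^{k})=c^{k}(t-a'_i)^{k}$ for all $k\in\mathbb{Z}$ and $i=1,\dots,n$. (b) There exists a constant $c\in\mathbb{C}^*$ such that, after reordering the $a_i$ and the $a'_i$ if necessary, $(a_i-a_1)(a'_i-a'_1)=c$ for all $i\neq1$, and for all $k\in\mathbb{Z}$ $$\varphi((t-a_1)^k)=\frac{c^{k}}{(t-a'_1)^{k}},\qquad \varphi((t-a_i)^k)=\frac{(a_1-a_i)^k(t-a'_i)^k}{(t-a'_1)^{k}}\quad\text{for all } i>1.$$ Moreover, whenever $m=n$ and the numerical conditions in (a) (respectively (b)) hold for some $c\in\mathbb{C}^*$, the formulas in (a) (respectively (b)) do define an algebra isomorphism $R_a\to R_{a'}$.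
   Context: All algebras are over $\mathbb{C}$, $n,m\ge 1$, and $\mathbb{C}^*=\mathbb{C}\setminus\{0\}$. For a tuple $a=(a_1,\dots,a_n)$ of distinct complex numbers, $R_a$ is the subalgebra of $\mathbb{C}(t)$ generated by $t,(t-a_1)^{-1},\dots,(t-a_n)^{-1}$. *)

(* Defs.v *)
From HB Require Import structures.
From mathcomp Require Import all_boot all_order all_algebra.
From mathcomp Require Import boolp reals complex.

Set Implicit Arguments.
Unset Strict Implicit.
Unset Printing Implicit Defensive.

Import GRing.Theory.

Local Open Scope ring_scope.

(* F(t); the fraction field of {poly F} carries no F-algebra structure in the
   library, so one is put on this alias. *)
Definition ratfun (F : fieldType) : Type := {fraction {poly F}}.

Section RatFun.
Variable F : fieldType.

HB.instance Definition _ := GRing.Field.copy (ratfun F) {fraction {poly F}}.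

Definition rconst (c : F) : ratfun F := tofrac c%:P.

Definition ratfun_scale (c : F) (x : ratfun F) : ratfun F := rconst c * x.

Fact ratfun_scaleA c d x :
  ratfun_scale c (ratfun_scale d x) = ratfun_scale (c * d) x.
Proof. by rewrite /ratfun_scale mulrA /rconst polyCM tofracM. Qed.

Fact ratfun_scale1 : left_id 1 ratfun_scale.
Proof. by move=> x; rewrite /ratfun_scale /rconst polyC1 tofrac1 mul1r. Qed.

Fact ratfun_scaleDr : right_distributive ratfun_scale +%R.
Proof. by move=> c x y; rewrite /ratfun_scale mulrDr. Qed.

Fact ratfun_scaleDl x : {morph ratfun_scale^~ x : c d / c + d}.
Proof. by move=> c d; rewrite /ratfun_scale /rconst polyCD tofracD mulrDl. Qed.

HB.instance Definition _ := GRing.Zmodule_isLmodule.Build F (ratfun F)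
  ratfun_scaleA ratfun_scale1 ratfun_scaleDr ratfun_scaleDl.

Fact ratfun_scaleAl c (x y : ratfun F) : c *: (x * y) = (c *: x) * y.
Proof. exact: mulrA. Qed.

HB.instance Definition _ :=
  GRing.Lmodule_isLalgebra.Build F (ratfun F) ratfun_scaleAl.

Fact ratfun_scaleAr c (x y : ratfun F) : c *: (x * y) = x * (c *: y).
Proof. by rewrite ![c *: _]/(rconst c * _) mulrCA. Qed.

HB.instance Definition _ :=
  GRing.Lalgebra_isAlgebra.Build F (ratfun F) ratfun_scaleAr.

Definition rvar : ratfun F := tofrac 'X.

End RatFun.

Section Ra.
Variables (F : fieldType) (n : nat) (a : 'I_n -> F).

Definition Ra_gens : {pred ratfun F} :=
  [pred x | (x == rvar F) ||
            [exists i, x == (rvar F - rconst (a i))^-1]].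

(* The subalgebra generated by Ra_gens: the intersection of all the
   subalgebras containing it. *)
Definition Ra_mem : {pred ratfun F} :=
  fun x => `[< forall S : {pred ratfun F},
                 GRing.subalg_closed S -> {subset Ra_gens <= S} -> x \in S >].

Fact Ra_subalg_closed : GRing.subalg_closed Ra_mem.
Proof.
split.
- by apply/asboolP => S [].
- move=> c x y /asboolP Hx /asboolP Hy; apply/asboolP => S HS gS.
  by have [_ lS _] := HS; apply: lS; [apply: Hx | apply: Hy].
- move=> x y /asboolP Hx /asboolP Hy; apply/asboolP => S HS gS.
  by have [_ _ mS] := HS; apply: mS; [apply: Hx | apply: Hy].
Qed.

HB.instance Definition _ :=
  GRing.isSubalgClosed.Build F (ratfun F) Ra_mem
    (GRing.subalg_closed_semi Ra_subalg_closed).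

Record Ra := MkRa { Ra_val :> ratfun F; Ra_valP : Ra_val \in Ra_mem }.

HB.instance Definition _ := [isSub for Ra_val].
HB.instance Definition _ := [Choice of Ra by <:].
HB.instance Definition _ := [SubChoice_isSubComNzRing of Ra by <:].
HB.instance Definition _ := [SubZmodule_isSubLmodule of Ra by <:].
HB.instance Definition _ := [SubNzRing_SubLmodule_isSubLalgebra of Ra by <:].
HB.instance Definition _ := [SubLalgebra_isSubAlgebra of Ra by <:].

Fact linpow_mem (i : 'I_n) (k : int) :
  (rvar F - rconst (a i)) ^ k \in Ra_mem.
Proof.
have tP : rvar F \in Ra_mem.
  by apply/asboolP => S _; apply; rewrite inE eqxx.
have iP : (rvar F - rconst (a i))^-1 \in Ra_mem.
  apply/asboolP => S _; apply; rewrite inE; apply/orP; right.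
  by apply/existsP; exists i.
have cP : rconst (a i) \in Ra_mem.
  by rewrite -[rconst _]mulr1; apply: (rpredZ (a i)); apply: rpred1.
case: k => k; first by apply: rpredX; apply: rpredB.
by rewrite NegzE -exprz_inv; apply: rpredX.
Qed.

(* (t - a_i)^k as an element of R_a, for any integer k *)
Definition linpow (i : 'I_n) (k : int) : Ra := MkRa (linpow_mem i k).

End Ra.

Definition fractional_linear (F : fieldType) (n m : nat)
    (a : 'I_n -> F) (a' : 'I_m -> F) (phi : Ra a -> Ra a') : Prop :=
  exists Phi : {lrmorphism ratfun F -> ratfun F},
    [/\ bijective Phi,
        (exists p q r s : F, p * s - q * r != 0 /\
           Phi (rvar F) =
             (p *: rvar F + rconst q) / (r *: rvar F + rconst s))
      & forall x : Ra a, Phi (Ra_val x) = Ra_val (phi x)].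

(* In the four predicates below, i1 is the index "1", and the bijections
   tau : 'I_n -> 'I_n and sigma : 'I_n -> 'I_m reorder the a_i and the a'_i:
   a_i becomes a (tau i) and a'_i becomes a' (sigma i). *)
Section Cases.
Variables (F : fieldType) (n m : nat) (i1 : 'I_n).
Variables (a : 'I_n -> F) (a' : 'I_m -> F).

Definition caseA_cond (sigma : 'I_n -> 'I_m) (c : F) : Prop :=
  forall i, a i - a i1 = c * (a' (sigma i) - a' (sigma i1)).

Definition caseA_formula (sigma : 'I_n -> 'I_m) (c : F)
    (phi : Ra a -> Ra a') : Prop :=
  forall (k : int) (i : 'I_n),
    Ra_val (phi (linpow a i k)) =
      (c ^ k) *: (rvar F - rconst (a' (sigma i))) ^ k.

Definition caseB_cond (tau : 'I_n -> 'I_n) (sigma : 'I_n -> 'I_m) (c : F)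
    : Prop :=
  forall i, i != i1 ->
    (a (tau i) - a (tau i1)) * (a' (sigma i) - a' (sigma i1)) = c.

Definition caseB_formula (tau : 'I_n -> 'I_n) (sigma : 'I_n -> 'I_m) (c : F)
    (phi : Ra a -> Ra a') : Prop :=
  forall k : int,
    Ra_val (phi (linpow a (tau i1) k)) =
      rconst (c ^ k) / (rvar F - rconst (a' (sigma i1))) ^ k
    /\ forall i, i != i1 ->
       Ra_val (phi (linpow a (tau i) k)) =
         ((a (tau i1) - a (tau i)) ^ k)
           *: (rvar F - rconst (a' (sigma i))) ^ k
         / (rvar F - rconst (a' (sigma i1))) ^ k.

(* The well-definedness of the map given by the formulas P includes its
   uniqueness among the algebra morphisms satisfying P. *)
Definition defines_iso (P : (Ra a -> Ra a') -> Prop) : Prop :=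
  exists phi : {lrmorphism Ra a -> Ra a'},
    [/\ bijective phi, P phi
      & forall psi : {lrmorphism Ra a -> Ra a'}, P psi -> psi =1 phi].

End Cases.

(* Main.v *)
(* Write phi(t) = p/q with p, q coprime. For c outside {a_i}, the element t - c
   is irreducible in R_a, hence so is its image (p - c q)/q in R_{a'}. If c also
   avoids the values p/q takes at the a'_j, two roots of p - c q would split
   this image into two non-units; so p - c q has degree at most 1 for two
   different c, and phi(t) is fractional linear. As each t - a_i is a unit,
   phi(t) takes the value a_i at some a'_j or at infinity: this matches the two
   sets of points, and (a) or (b) holds according to whether the pole of phi(t)
   is infinity or some a'_j. *)
Require Import Defs.
From HB Require Import structures.
From mathcomp Require Import all_boot all_order all_algebra.
From mathcomp Require Import perm generic_quotient ring.
From mathcomp Require Import boolp reals complex.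

Set Implicit Arguments.
Unset Strict Implicit.
Unset Printing Implicit Defensive.

Import GRing.Theory.

Local Open Scope ring_scope.

(** * Rational functions as fractions of polynomials, and their endomorphisms *)

Lemma fraction_fracE (R : idomainType) (x : {fraction R}) :
  exists n d, d != 0 /\ x = tofrac n / tofrac d.
Proof.
elim/quotW: x => r; exists (\n_r), (\d_r); split; first exact: denom_ratioP.
apply: (canRL (mulfK _)); first by rewrite tofrac_eq0 denom_ratioP.
unlock tofrac; rewrite -[LHS]FracField.pi_mul; apply/eqmodP.
rewrite /= FracField.equivfE /FracField.mulf.
by rewrite !numden_Ratio ?mulf_neq0 ?oner_neq0 ?denom_ratioP // !mulr1 mulrC.
Qed.

Section RationalFunctions.
Variable F : fieldType.
Implicit Types (c z : F) (p q : {poly F}) (x y : ratfun F).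
Local Notation t := (rvar F).

(** The map [tofrac], retyped so that its morphism structures land in the alias [ratfun F], which
    carries the [F]-algebra structure. *)
Definition ratpoly : {poly F} -> ratfun F := @tofrac {poly F}.

HB.instance Definition _ := GRing.isZmodMorphism.Build {poly F} (ratfun F)
  ratpoly (@tofrac_is_zmod_morphism {poly F}).
HB.instance Definition _ := GRing.isMonoidMorphism.Build {poly F} (ratfun F)
  ratpoly (@tofrac_is_monoid_morphism {poly F}).

Lemma ratpoly_eq0 p : (ratpoly p == 0) = (p == 0).
Proof. exact: tofrac_eq0. Qed.

Lemma ratpoly_inj : injective ratpoly.
Proof. by move=> p q /eqP; rewrite tofrac_eq => /eqP. Qed.

Lemma ratfun_fracE x : exists p q, q != 0 /\ x = ratpoly p / ratpoly q.
Proof. exact: fraction_fracE. Qed.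

Lemma ratfun_coprimeE x :
  exists p q, [/\ q != 0, coprimep p q & x = ratpoly p / ratpoly q].
Proof.
have [p [q [q0 ->]]] := ratfun_fracE x.
have g0 : gcdp p q != 0 by rewrite gcdp_eq0 negb_and q0 orbT.
have qE := divpK (dvdp_gcdr p q); have pE := divpK (dvdp_gcdl p q).
exists (p %/ gcdp p q), (q %/ gcdp p q); split.
- by apply: contra_neq q0 => h; rewrite -qE h mul0r.
- by rewrite coprimep_div_gcd // q0 orbT.
rewrite -[X in ratpoly X / _ = _]pE -[X in _ / ratpoly X = _]qE !rmorphM /=.
rewrite -mulf_div divff ?mulr1 //.
by rewrite ratpoly_eq0.
Qed.

Fact rconst_is_zmod_morphism : zmod_morphism (@rconst F).
Proof. by move=> c d; rewrite /rconst polyCB tofracB. Qed.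
Fact rconst_is_monoid_morphism : monoid_morphism (@rconst F).
Proof. by split=> [|c d]; rewrite /rconst ?polyC1 ?tofrac1 // polyCM tofracM. Qed.
HB.instance Definition _ := GRing.isZmodMorphism.Build F (ratfun F)
  (@rconst F) rconst_is_zmod_morphism.
HB.instance Definition _ := GRing.isMonoidMorphism.Build F (ratfun F)
  (@rconst F) rconst_is_monoid_morphism.

Lemma rconst_eq0 c : (rconst c == 0) = (c == 0).
Proof. exact: fmorph_eq0. Qed.

Lemma ratfun_scaleE c x : c *: x = rconst c * x.
Proof. by []. Qed.

Lemma rconstE c : rconst c = c%:A.
Proof. by rewrite ratfun_scaleE mulr1. Qed.

Lemma ratpolyC c : ratpoly c%:P = rconst c.
Proof. by []. Qed.

Lemma ratpolyX : ratpoly 'X = t.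
Proof. by []. Qed.

Lemma ratpolyXsubC c : ratpoly ('X - c%:P) = t - rconst c.
Proof. by rewrite rmorphB. Qed.

Lemma rvar_sub_neq0 c : t - rconst c != 0.
Proof. by rewrite -ratpolyXsubC ratpoly_eq0 polyXsubC_eq0. Qed.

Lemma lrmorph_rconst (f : {lrmorphism ratfun F -> ratfun F}) c :
  f (rconst c) = rconst c.
Proof. by rewrite rconstE linearZ rmorph1. Qed.

Lemma lrmorph_ratpoly (f : {lrmorphism ratfun F -> ratfun F}) p :
  f (ratpoly p) = horner_alg (f t) p.
Proof.
elim/poly_ind: p => [|p c IH]; first by rewrite !rmorph0.
rewrite !rmorphD !rmorphM /= IH horner_algX horner_algC -rconstE.
by rewrite ratpolyC lrmorph_rconst.
Qed.

Lemma ratfun_lrmorph_ext (f g : {lrmorphism ratfun F -> ratfun F}) :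
  f t = g t -> f =1 g.
Proof.
move=> fg x; have [p [q [_ ->]]] := ratfun_fracE x.
rewrite (fmorph_div f) (fmorph_div g) /= (lrmorph_ratpoly f p).
by rewrite (lrmorph_ratpoly f q) (lrmorph_ratpoly g p) (lrmorph_ratpoly g q) fg.
Qed.

(** Over an algebraically closed field these are the elements transcendental over [F], that is, the
    possible images of t under an endomorphism of F(t). *)
Definition nonconst y := forall c, y != rconst c.

Lemma nonconst_rvar : nonconst t.
Proof.
by move=> c; rewrite -subr_eq0 rvar_sub_neq0.
Qed.

End RationalFunctions.

(** * Substitution of a nonconstant element for t *)

Section Substitution.
Variable F : closedFieldType.
Implicit Types (y : ratfun F) (p q : {poly F}).
Local Notation t := (rvar F).

(* Over an algebraically closed field p(y) is a product of factors y - z. *)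
Lemma nonconst_horner_neq0 y p : nonconst y -> p != 0 -> horner_alg y p != 0.
Proof.
move=> ny p0; have [r pE] := closed_field_poly_normal p.
rewrite pE linearZ /= rmorph_prod ratfun_scaleE mulf_neq0 //.
  by rewrite mulr1 rconst_eq0 lead_coef_eq0.
rewrite prodf_seq_neq0; apply/allP => z _ /=.
by rewrite rmorphB /= horner_algX horner_algC -rconstE subr_eq0.
Qed.

(** The endomorphism sends p/q to p(y)/q(y); this makes sense because no nonzero polynomial vanishes
    at a nonconstant [y]. *)
Lemma exists_subst y : nonconst y ->
  exists f : {lrmorphism ratfun F -> ratfun F}, f t = y.
Proof.
move=> ny; have ev0 p : p != 0 -> horner_alg y p != 0.
  exact: nonconst_horner_neq0.
(* The chosen fractions need not be reduced: [fE] shows by cross-multiplication that the value does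
   not depend on the choice. *)
have h x : {pq : {poly F} * {poly F} |
    pq.2 != 0 /\ x = ratpoly pq.1 / ratpoly pq.2}.
  by apply: cid; have [p [q ?]] := ratfun_fracE x; exists (p, q).
pose f x := horner_alg y (sval (h x)).1 / horner_alg y (sval (h x)).2.
have fE p q : q != 0 ->
    f (ratpoly p / ratpoly q) = horner_alg y p / horner_alg y q.
  rewrite /f; case: (h _) => -[p' q'] /= [q'0 e] q0.
  apply/eqP; rewrite eqr_div ?ev0 // -!rmorphM; apply/eqP; congr horner_alg.
  apply: ratpoly_inj; move/eqP: e; rewrite eqr_div ?ratpoly_eq0 //.
  by move/eqP; rewrite -!rmorphM => <-.
have fp p : f (ratpoly p) = horner_alg y p.
  by have := fE p 1 (oner_neq0 _); rewrite !rmorph1 !divr1.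
have fadd : zmod_morphism f.
  move=> x z; have [p [q [q0 ->]]] := ratfun_fracE x.
  have [p' [q' [q'0 ->]]] := ratfun_fracE z.
  rewrite -mulNr addf_div ?ratpoly_eq0 // -rmorphN -!rmorphM -rmorphD.
  rewrite !fE ?mulf_neq0 // -[in RHS]mulNr addf_div ?ev0 //.
  by rewrite -rmorphN -!rmorphM -rmorphD.
have fmul : monoid_morphism f.
  split=> [|x z]; first by have := fp 1; rewrite !rmorph1.
  have [p [q [q0 ->]]] := ratfun_fracE x.
  have [p' [q' [q'0 ->]]] := ratfun_fracE z.
  by rewrite mulf_div -!rmorphM !fE ?mulf_neq0 // mulf_div -!rmorphM.
have fscal : scalable f.
  move=> c x; rewrite !ratfun_scaleE fmul -ratpolyC fp horner_algC.
  by rewrite ratpolyC rconstE.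
pose fA := GRing.isZmodMorphism.Build (ratfun F) (ratfun F) f fadd.
pose fM := GRing.isMonoidMorphism.Build (ratfun F) (ratfun F) f fmul.
pose fZ := GRing.isScalable.Build F (ratfun F) (ratfun F) *:%R f fscal.
pose g : {lrmorphism ratfun F -> ratfun F} := HB.pack f fA fM fZ.
by exists g; rewrite /= -ratpolyX fp horner_algX.
Qed.

End Substitution.

(** * The algebra R_a: regularity, poles, units and irreducible elements *)

(** First-order expansion of 1/(u - v) around u = w; it handles the generators 1/(t - a_i) in
    [Ra_split]. *)
Lemma inv_sub_split (K : fieldType) (u v w : K) : u - v != 0 -> w - v != 0 ->
  (u - v)^-1 = (w - v)^-1 + (u - w) * (- (w - v)^-1 * (u - v)^-1).
Proof. by move=> uv wv; field; rewrite uv wv. Qed.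

(** Expanding the product shows that [w] divides [c * d]. With [c], [d] nonzero constants this makes
    [w] a unit of any algebra containing [u], [v] and [w]. *)
Lemma inv_of_prod_split (K : fieldType) (c d u v w : K) :
    w != 0 -> c * d != 0 -> w = (c + w * u) * (d + w * v) ->
  w^-1 = (c * d)^-1 * (1 - u * (d + w * v) - c * v).
Proof.
move=> w0 cd0 e; apply: (mulfI w0); apply: (mulfI cd0).
rewrite mulfV // mulr1 mulrCA [c * d * _]mulrA mulfV // mul1r.
by rewrite !mulrBr mulr1 {1}e; ring.
Qed.

Section RaStructure.
Variables (F : fieldType) (n : nat) (a : 'I_n -> F).
Implicit Types (b c : F) (x y : ratfun F) (p q : {poly F}).
Local Notation t := (rvar F).

Lemma Ra_mem_min (S : {pred ratfun F}) :
  GRing.subalg_closed S -> {subset Ra_gens a <= S} -> {subset Ra_mem a <= S}.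
Proof. by move=> Sc Sg x /asboolP/(_ S Sc Sg). Qed.

Lemma rvar_Ra : t \in Ra_mem a.
Proof. by apply/asboolP => S _; apply; rewrite inE eqxx. Qed.

Lemma rconst_Ra c : rconst c \in Ra_mem a.
Proof. by rewrite rconstE rpredZ ?rpred1. Qed.

Lemma rvar_sub_Ra c : t - rconst c \in Ra_mem a.
Proof. by rewrite rpredB ?rvar_Ra ?rconst_Ra. Qed.

Lemma rvar_sub_inv_Ra i : (t - rconst (a i))^-1 \in Ra_mem a.
Proof. exact: (linpow_mem a i (-1)). Qed.

Lemma lrmorph_Ra_mem m (a' : 'I_m -> F)
    (f : {lrmorphism ratfun F -> ratfun F}) :
    f t \in Ra_mem a' -> (forall i, (f (t - rconst (a i)))^-1 \in Ra_mem a') ->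
  forall x, x \in Ra_mem a -> f x \in Ra_mem a'.
Proof.
move=> ft fi; apply: (@Ra_mem_min [pred x | f x \in Ra_mem a']).
  split=> [|c x y|x y]; rewrite !inE ?rmorph1 ?rpred1 //.
    by move=> fx fy; rewrite linearP rpredD ?rpredZ.
  by move=> fx fy; rewrite rmorphM rpredM.
move=> x; rewrite !inE => /orP[/eqP->//|/existsP[i /eqP->]].
by rewrite (fmorphV f) fi.
Qed.

(** Membership in the local ring at [b]; the fraction need not be reduced. *)
Definition regular_at b x :=
  exists p q, q.[b] != 0 /\ x = ratpoly p / ratpoly q.

(** The elements regular at [b] form a subalgebra, and it contains the generators when [b] is none
    of the a_i. *)
Lemma Ra_regular b x :
  (forall i, a i != b) -> x \in Ra_mem a -> regular_at b x.
Proof.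
have neq0 q : q.[b] != 0 -> ratpoly q != 0.
  by apply: contraNneq => /eqP; rewrite ratpoly_eq0 => /eqP->; rewrite horner0.
have polyP p : regular_at b (ratpoly p).
  by exists p, 1; rewrite hornerC oner_eq0 rmorph1 divr1.
move=> ab; pose S : {pred ratfun F} := fun x => `[< regular_at b x >].
suff H : {subset Ra_mem a <= S} by move=> /H/asboolP.
apply: Ra_mem_min => [|{}x].
  split=> [|c {}x y|{}x y].
  - by apply/asboolP; have := polyP 1; rewrite rmorph1.
  - move=> /asboolP[p [q [q0 ->]]] /asboolP[p' [q' [q'0 ->]]]; apply/asboolP.
    exists (c%:P * p * q' + p' * q), (q * q'); rewrite hornerM mulf_neq0 //.
    split=> //; rewrite ratfun_scaleE mulrA addf_div ?neq0 //.
    by rewrite rmorphD !rmorphM /= ratpolyC.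
  - move=> /asboolP[p [q [q0 ->]]] /asboolP[p' [q' [q'0 ->]]]; apply/asboolP.
    exists (p * p'), (q * q'); rewrite hornerM mulf_neq0 //.
    by rewrite mulf_div -!rmorphM.
rewrite !inE => /orP[/eqP->|/existsP[i /eqP->]]; apply/asboolP.
  by rewrite -ratpolyX.
exists 1, ('X - (a i)%:P).
by rewrite hornerXsubC subr_eq0 eq_sym ab ratpolyXsubC rmorph1 div1r.
Qed.

Lemma regular_at_frac b p q : q != 0 -> q.[b] = 0 ->
  regular_at b (ratpoly p / ratpoly q) -> p.[b] = 0.
Proof.
move=> q0 qb [u [v [vb /eqP]]].
have v0 : v != 0 by apply: contraNneq vb => ->; rewrite horner0.
rewrite eqr_div ?ratpoly_eq0 // -!rmorphM => /eqP/ratpoly_inj/(congr1 (horner^~ b)).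
by rewrite !hornerM qb mulr0 => /eqP; rewrite mulf_eq0 (negPf vb) orbF => /eqP.
Qed.

(** If [b] were none of the a_i, the fraction would be regular at [b], which forces [p] to vanish
    there with [q]. *)
Lemma Ra_pole b p q : q != 0 -> q.[b] = 0 -> p.[b] != 0 ->
  ratpoly p / ratpoly q \in Ra_mem a -> exists i, a i = b.
Proof.
move=> q0 qb pb pqR; case: (pselect (exists i, a i = b)) => // nab.
case/eqP: pb; apply: (regular_at_frac q0 qb); apply: Ra_regular pqR => i.
by apply/eqP => e; apply: nab; exists i.
Qed.

Lemma rvar_sub_inv_RaP b :
  (t - rconst b)^-1 \in Ra_mem a -> exists i, a i = b.
Proof.
rewrite -div1r -(rmorph1 (@ratpoly F)) -ratpolyXsubC.
by apply: Ra_pole; rewrite ?polyXsubC_eq0 ?hornerXsubC ?subrr ?hornerC ?oner_eq0.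
Qed.

Lemma rvar_sub_not_unit b :
  (forall i, a i != b) -> (t - rconst b)^-1 \notin Ra_mem a.
Proof.
by move=> ab; apply/negP => /rvar_sub_inv_RaP[i /eqP]; rewrite (negPf (ab i)).
Qed.

(** The constant is the value of [x] at [b]: modulo t - b the algebra reduces to [F]. The set [S]
    also records membership in R_a, which the product case needs for its cofactor. *)
Lemma Ra_split b x : (forall i, a i != b) -> x \in Ra_mem a ->
  exists c y, y \in Ra_mem a /\ x = rconst c + (t - rconst b) * y.
Proof.
move=> ab.
pose S : {pred ratfun F} := fun x => `[< x \in Ra_mem a /\
  exists c y, y \in Ra_mem a /\ x = rconst c + (t - rconst b) * y >].
suff H : {subset Ra_mem a <= S} by move=> /H/asboolP[].
apply: Ra_mem_min => [|{}x].
  split=> [|k x1 x2|x1 x2].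
  - apply/asboolP; split; first exact: rpred1.
    by exists 1, 0; rewrite rpred0 mulr0 addr0 rmorph1.
  - move=> /asboolP[x1R [c [y [yR e1]]]] /asboolP[x2R [d [z [zR e2]]]].
    apply/asboolP; split; first by rewrite rpredD ?rpredZ.
    exists (k * c + d), (k *: y + z); rewrite rpredD ?rpredZ //; split=> //.
    by rewrite e1 e2 !ratfun_scaleE rmorphD rmorphM; ring.
  - move=> /asboolP[x1R [c [y [yR e1]]]] /asboolP[x2R [d [z [zR e2]]]].
    apply/asboolP; split; first by rewrite rpredM.
    exists (c * d), (rconst c * z + y * x2).
    rewrite rpredD ?rpredM ?rconst_Ra //; split=> //.
    by rewrite e1 e2 rmorphM; ring.
rewrite !inE => /orP[/eqP->|/existsP[i /eqP->]]; apply/asboolP.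
  split; first exact: rvar_Ra.
  by exists b, 1; rewrite rpred1 mulr1 addrC subrK.
split; first exact: rvar_sub_inv_Ra.
have bi0 : rconst b - rconst (a i) != 0 :> ratfun F.
  by rewrite -rmorphB rconst_eq0 subr_eq0 eq_sym.
exists (b - a i)^-1, (- rconst (b - a i)^-1 * (t - rconst (a i))^-1).
rewrite rpredM ?rpredN ?rconst_Ra ?rvar_sub_inv_Ra //; split=> //.
rewrite (fmorphV (@rconst F)) rmorphB /=.
exact: inv_sub_split (rvar_sub_neq0 _) bi0.
Qed.

(** Split both factors at [b]. If one constant term vanishes, that factor is a multiple of t - b,
    and cancelling t - b makes the other factor a unit. If neither vanishes, [inv_of_prod_split]
    makes t - b a unit, which it is not. *)
Lemma rvar_sub_irreducible b x y : (forall i, a i != b) ->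
    x \in Ra_mem a -> y \in Ra_mem a -> t - rconst b = x * y ->
  x^-1 \in Ra_mem a \/ y^-1 \in Ra_mem a.
Proof.
move=> ab xR yR e; have tb0 := rvar_sub_neq0 b.
have [c [u [uR xE]]] := Ra_split ab xR.
have [d [v [vR yE]]] := Ra_split ab yR.
have half c0 x0 u0 y0 : u0 \in Ra_mem a -> x0 = rconst c0 + (t - rconst b) * u0 ->
    t - rconst b = x0 * y0 -> c0 = 0 -> y0^-1 \in Ra_mem a.
  move=> u0R -> e0 c00; suff: y0 * u0 = 1 by move/mulr1_eq->.
  move: e0; rewrite c00 rmorph0 add0r -mulrA -{1}[t - _]mulr1.
  by move/(mulfI tb0) ->; rewrite mulrC.
have [c0|c0] := eqVneq c 0; first by right; apply: half uR xE e c0.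
have [d0|d0] := eqVneq d 0.
  by left; apply: half vR yE _ d0; rewrite e mulrC.
have /negP[] := rvar_sub_not_unit ab.
have cd0 : rconst c * rconst d != 0 :> ratfun F.
  by rewrite mulf_neq0 ?rconst_eq0.
rewrite (inv_of_prod_split tb0 cd0 (u := u) (v := v)) -?xE -?yE //.
rewrite -rmorphM -(fmorphV (@rconst F)).
by rewrite rpredM ?rpredB ?rpredM ?rpred1 ?rconst_Ra.
Qed.

Definition Ra_var : Ra a := MkRa rvar_Ra.

Fact Ra_val_is_zmod_morphism : zmod_morphism (@Ra_val F n a).
Proof. by []. Qed.
Fact Ra_val_is_monoid_morphism : monoid_morphism (@Ra_val F n a).
Proof. by []. Qed.
Fact Ra_val_is_scalable : scalable (@Ra_val F n a).
Proof. by []. Qed.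
HB.instance Definition _ := GRing.isZmodMorphism.Build (Ra a) (ratfun F)
  (@Ra_val F n a) Ra_val_is_zmod_morphism.
HB.instance Definition _ := GRing.isMonoidMorphism.Build (Ra a) (ratfun F)
  (@Ra_val F n a) Ra_val_is_monoid_morphism.
HB.instance Definition _ := GRing.isScalable.Build F (Ra a) (ratfun F) *:%R
  (@Ra_val F n a) Ra_val_is_scalable.

(** The elements on which [f] and [g] agree form a subalgebra; it contains t, and then each 1/(t -
    a_i) by uniqueness of inverses in a field. *)
Lemma Ra_lrmorph_ext (f g : {lrmorphism Ra a -> ratfun F}) :
  f Ra_var = g Ra_var -> f =1 g.
Proof.
move=> fg; pose S : {pred ratfun F} :=
  fun x => `[< exists y : Ra a, Ra_val y = x /\ f y = g y >].
suff H : {subset Ra_mem a <= S}.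
  move=> x; have /H/asboolP[y [yx fgy]] := Ra_valP x.
  by rewrite -(val_inj yx : y = x).
have fgc c : f (c%:A) = g (c%:A) by rewrite !linearZ !rmorph1.
apply: Ra_mem_min => [|x].
  split=> [|c x y|x y].
  - by apply/asboolP; exists 1; rewrite !rmorph1.
  - move=> /asboolP[u [<- fu]] /asboolP[v [<- fv]]; apply/asboolP.
    by exists (c *: u + v); split=> //; rewrite !linearP /= fu fv.
  - move=> /asboolP[u [<- fu]] /asboolP[v [<- fv]]; apply/asboolP.
    by exists (u * v); split=> //; rewrite !rmorphM /= fu fv.
rewrite !inE => /orP[/eqP->|/existsP[i /eqP->]]; apply/asboolP.
  by exists Ra_var.
exists (linpow a i (-1)); split=> //.
have e : linpow a i (-1) * (Ra_var - (a i)%:A) = 1.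
  by apply: val_inj; rewrite /= -rconstE mulVf // rvar_sub_neq0.
have fe : f (linpow a i (-1)) * f (Ra_var - (a i)%:A) = 1.
  by rewrite -rmorphM e rmorph1.
(* As [f] and [g] agree on t - a_i, the image of its inverse under [g] is also inverse to
   [f (t - a_i)]. *)
have ge : g (linpow a i (-1)) * f (Ra_var - (a i)%:A) = 1.
  by rewrite rmorphB /= fg fgc -rmorphB /= -rmorphM e rmorph1.
have : f (Ra_var - (a i)%:A) != 0.
  by apply/eqP => f0; move: fe; rewrite f0 mulr0 => /esym/eqP; rewrite oner_eq0.
by move/mulIf; apply; rewrite fe ge.
Qed.

End RaStructure.

(** * Isomorphisms between two such algebras are fractional linear *)

Lemma lrmorph_inverse (F : fieldType) (A B : algType F)
    (f : {lrmorphism A -> B}) : bijective f ->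
  exists g : {lrmorphism B -> A}, cancel f g /\ cancel g f.
Proof.
case=> g fK gK.
pose gA := GRing.isZmodMorphism.Build B A g (can2_zmod_morphism fK gK).
pose gM := GRing.isMonoidMorphism.Build B A g (can2_monoid_morphism fK gK).
pose gZ := GRing.isScalable.Build F B A *:%R g (can2_scalable fK gK).
by exists (HB.pack g gA gM gZ : {lrmorphism B -> A}).
Qed.

Lemma closed_field_avoid (F : closedFieldType) (s : seq F) :
  exists c, c \notin s.
Proof.
(* At an element of [s] this polynomial takes the value 1, so its roots lie outside [s]; the factor
   ['X] keeps it nonconstant even for empty [s]. *)
pose p := \prod_(z <- s) ('X - z%:P) * 'X + 1%:P : {poly F}.
have /closed_rootP[c] : size p != 1.
  by rewrite size_MXaddC oner_eq0 andbF size_prod_XsubC.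
rewrite /root !hornerE horner_prod => pc; exists c; apply/negP => cs.
have := pc; rewrite (big_rem c) //= !hornerE subrr !mul0r add0r.
by rewrite oner_eq0.
Qed.

Section Isomorphism.
Variables (F : closedFieldType) (n m : nat).
Variables (a : 'I_n -> F) (a' : 'I_m -> F).
Local Notation t := (rvar F).

Lemma Ra_morph_nonconst (phi : {lrmorphism Ra a -> Ra a'}) :
  injective phi -> nonconst (phi (Ra_var a)).
Proof.
move=> phiI c; apply/eqP => e.
have : phi (Ra_var a) = phi c%:A.
  by apply: val_inj; rewrite linearZ rmorph1 /= e rconstE.
move/phiI/(congr1 \val) => /= /eqP.
by rewrite -rconstE (negPf (nonconst_rvar _)).
Qed.

Lemma Ra_morph_invP (phi : {lrmorphism Ra a -> Ra a'}) (x : Ra a) :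
  (Ra_val x)^-1 \in Ra_mem a -> (Ra_val (phi x))^-1 \in Ra_mem a'.
Proof.
(* For [x = 0] the convention [0^-1 = 0] makes the claim trivially true. *)
move=> xV; have [->|x0] := eqVneq x 0; first by rewrite rmorph0 invr0 rpred0.
have v0 : Ra_val x != 0.
  by apply: contra_neq x0 => e; apply: val_inj; rewrite /= e.
have e : x * MkRa xV = 1 by apply: val_inj; apply: mulfV v0.
have pe : phi x * phi (MkRa xV) = 1.
  by apply: etrans (esym (rmorphM phi x _)) _; rewrite e; exact: rmorph1.
have : Ra_val (phi x) * Ra_val (phi (MkRa xV)) = 1.
  by have := congr1 val pe.
by move/mulr1_eq ->; apply: Ra_valP.
Qed.

(** Substituting phi(t) for t gives an endomorphism of F(t) that agrees with [phi] on t, hence on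
    all of R_a. *)
Lemma Ra_morph_extend (phi : {lrmorphism Ra a -> Ra a'}) : injective phi ->
  exists Phi : {lrmorphism ratfun F -> ratfun F},
    forall x, Phi (Ra_val x) = Ra_val (phi x).
Proof.
move=> phiI; have [Phi PhiE] := exists_subst (Ra_morph_nonconst phiI).
pose f : {lrmorphism Ra a -> ratfun F} := Phi \o @Ra_val _ _ a.
pose g : {lrmorphism Ra a -> ratfun F} := @Ra_val _ _ a' \o phi.
by exists Phi => x; apply: (Ra_lrmorph_ext (f := f) (g := g)).
Qed.

(** With two roots b, b' of d = p - c q, counted with multiplicity, the image d/q of the irreducible
    t - c factors as (t - b) times e/q. Neither factor is a unit of R_{a'}, since neither root is
    one of the a'_j. *)
Lemma Ra_iso_degree (phi : {lrmorphism Ra a -> Ra a'})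
    (psi : {lrmorphism Ra a' -> Ra a}) (p q : {poly F}) (c : F) :
    cancel phi psi -> cancel psi phi -> q != 0 -> coprimep p q ->
    Ra_val (phi (Ra_var a)) = ratpoly p / ratpoly q ->
    (forall i, a i != c) -> (forall j, (p - c *: q).[a' j] != 0) ->
  (size (p - c *: q)%R <= 2)%N.
Proof.
move=> phiK psiK q0 pq phiE ac; move dd: (p - c *: q) => d da'.
rewrite leqNgt; apply/negP => d3.
(* A degree of at least two gives a root [b] of [d] and a root [b'] of the quotient [e], possibly
   equal to [b]. *)
have /closed_rootP[b /factor_theorem[e dE]] : size d != 1%N.
  by rewrite neq_ltn (ltn_trans _ d3) ?orbT.
have d0 : d != 0 by rewrite -size_poly_gt0 (ltn_trans _ d3).
have e0 : e != 0 by apply: contra_neq d0 => e0; rewrite dE e0 mul0r.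
have /closed_rootP[b' /rootP eb'] : size e != 1%N.
  move: d3; rewrite dE size_Mmonic ?monicXsubC // size_XsubC addn2 /=.
  by rewrite ltnS; case: (size e) => [|[]].
have db' : d.[b'] = 0 by rewrite dE hornerM eb' mul0r.
have db : d.[b] = 0 by rewrite dE hornerM hornerXsubC subrr mulr0.
(* A common root of [d] and [q] would be a root of [p], against coprimality. *)
have qd z : d.[z] = 0 -> q.[z] != 0.
  move=> dz; apply/eqP => qz; move: dz; rewrite -dd !hornerE qz mulr0 subr0 => pz.
  by have := coprimep_root pq (introT rootP pz); rewrite qz eqxx.
have ab j : a' j != b.
  by apply: contraNneq (da' j) => ->; rewrite db.
have ab' j : a' j != b'.
  by apply: contraNneq (da' j) => ->; rewrite db'.
pose f := phi (Ra_var a - c%:A).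
have fE : Ra_val f = ratpoly d / ratpoly q.
  have -> : f = phi (Ra_var a) - c%:A.
    by apply: etrans (rmorphB phi _ _) _; congr (_ - _); apply: rmorph_alg.
  rewrite [LHS]/= phiE -rconstE -dd rmorphB /=.
  rewrite -mul_polyC rmorphM /= ratpolyC mulrBl mulfK ?ratpoly_eq0 //.
(* This places the cofactor [h] in R_{a'}: the constant [k] is the value of d/q at [b], which is
   zero. *)
have [k [h [hR fh]]] := Ra_split ab (Ra_valP f).
have k0 : k = 0.
  have dq0 : q * ('X - b%:P) != 0 by rewrite mulf_neq0 ?polyXsubC_eq0.
  have hE : h = ratpoly (d - k *: q) / ratpoly (q * ('X - b%:P)).
    apply: (canRL (mulfK _)); first by rewrite ratpoly_eq0.
    have dE' : ratpoly d = (rconst k + (t - rconst b) * h) * ratpoly q.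
      by rewrite -fh fE divfK ?ratpoly_eq0.
    rewrite -mul_polyC rmorphB /= dE' !rmorphM /= ratpolyC ratpolyXsubC.
    by rewrite mulrDl [X in _ = X - _]addrC addrK mulrA mulrC mulrA.
  have qb : (q * ('X - b%:P)).[b] = 0.
    by rewrite hornerM hornerXsubC subrr mulr0.
  have := Ra_regular ab hR; rewrite hE => /(regular_at_frac dq0 qb).
  rewrite !hornerE db sub0r => /eqP.
  by rewrite oppr_eq0 mulf_eq0 (negPf (qd b db)) orbF => /eqP.
rewrite k0 rmorph0 add0r in fh.
have hE : h = ratpoly e / ratpoly q.
  apply: (mulfI (rvar_sub_neq0 b)).
  by rewrite -fh fE dE rmorphM /= ratpolyXsubC -mulrA mulrCA.
pose x := MkRa (rvar_sub_Ra a' b); pose y := MkRa hR.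
have fxy : f = x * y by apply: val_inj; exact: fh.
have psif : Ra_var a - c%:A = psi x * psi y.
  exact: etrans (esym (phiK _)) (etrans (congr1 psi fxy) (rmorphM psi x y)).
have /(congr1 \val) /= := psif; rewrite -rconstE.
have inv z : (Ra_val (psi z))^-1 \in Ra_mem a -> (Ra_val z)^-1 \in Ra_mem a'.
  by move/(Ra_morph_invP phi); have -> : phi (psi z) = z := psiK z.
case/(rvar_sub_irreducible ac (Ra_valP _) (Ra_valP _)) => /inv /=.
  by apply/negP/rvar_sub_not_unit.
(* An inverse q/e of the second factor would have a pole at [b'], outside the a'_j. *)
rewrite hE invf_div.
by case/(Ra_pole e0 eb' (qd _ db')) => j /eqP; rewrite (negPf (ab' j)).
Qed.

(** All but finitely many c satisfy the hypotheses of [Ra_iso_degree]. Two such values c, d bound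
    the degree of q, because (d - c) q is the difference of p - c q and p - d q; the bound for p
    follows. *)
Lemma Ra_iso_moebius (phi : {lrmorphism Ra a -> Ra a'})
    (psi : {lrmorphism Ra a' -> Ra a}) :
    cancel phi psi -> cancel psi phi ->
  exists p q r s : F, p * s - q * r != 0 /\
    Ra_val (phi (Ra_var a)) =
      (p *: t + rconst q) / (r *: t + rconst s).
Proof.
move=> phiK psiK; have := Ra_morph_nonconst (can_inj phiK).
have [p [q [q0 pq phiE]]] := ratfun_coprimeE (phi (Ra_var a)).
(* Where [q] vanishes at a'_j the quotient is 0 by convention. This only excludes c = 0 as well;
   there p - c q is nonzero at a'_j by coprimality. *)
pose bad := codom a ++ codom (fun j => p.[a' j] / q.[a' j]).
have deg c : c \notin bad -> (size (p - c *: q)%R <= 2)%N.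
  rewrite mem_cat negb_or => /andP[ac pqc].
  apply: (Ra_iso_degree phiK psiK q0 pq phiE) => [i|j].
    by apply: contraNneq ac => <-; apply: codom_f.
  rewrite !hornerE subr_eq0; apply: contra pqc => /eqP e.
  have q'0 : q.[a' j] != 0.
    apply/eqP => q'0; have p'0 : root p (a' j) by rewrite /root e q'0 mulr0.
    by have := coprimep_root pq p'0; rewrite q'0 eqxx.
  by rewrite -[c](mulfK q'0) -e; apply: codom_f (fun j => p.[a' j] / q.[a' j]) j.
have [c c_bad] := closed_field_avoid bad.
have [d] := closed_field_avoid (c :: bad).
rewrite inE negb_or => /andP[dc d_bad].
have q2 : (size q <= 2)%N.
  have cd0 : d - c != 0 by rewrite subr_eq0.
  rewrite -(size_scale q cd0).
  have -> : (d - c) *: q = (p - c *: q) - (p - d *: q).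
    by rewrite scalerBl opprB [RHS]addrC subrKA.
  by rewrite (leq_trans (size_polyD _ _)) // size_polyN geq_max !deg.
have p2 : (size p <= 2)%N.
  rewrite -(subrK (c *: q) p) (leq_trans (size_polyD _ _)) // geq_max deg //=.
  by rewrite (leq_trans (size_scale_leq _ _)).
have linE (u : {poly F}) : (size u <= 2)%N -> u = u`_1 *: 'X + (u`_0)%:P.
  move=> u2; apply/polyP => -[|[|i]]; rewrite !coefE ?mulr0 ?add0r ?mulr1 ?addr0 //.
  by rewrite nth_default // (leq_trans u2).
have ratE (u : {poly F}) : (size u <= 2)%N ->
    ratpoly u = u`_1 *: t + rconst u`_0.
  by move=> /linE {1}->; rewrite rmorphD -mul_polyC rmorphM.
rewrite phiE => nc; exists p`_1, p`_0, q`_1, q`_0; rewrite -!ratE //; split=> //.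
apply/eqP => /eqP; rewrite subr_eq0 => /eqP det0.
(* A zero determinant would make [p] and [q] proportional, hence phi(t) constant. *)
have const u v : v != 0 -> v *: p = u *: q -> False.
  move=> v0 e; have /eqP[] := nc (u / v).
  have rv0 : ratpoly v%:P != 0 by rewrite ratpolyC rconst_eq0.
  apply/eqP; rewrite -[_ == _](inj_eq (mulfI rv0)) mulrA -rmorphM /=.
  rewrite mul_polyC e -mul_polyC rmorphM /= mulfK ?ratpoly_eq0 //.
  by rewrite !ratpolyC -rmorphM mulrCA mulfV ?mulr1.
have [q1|q1] := eqVneq q`_1 0.
  have q00 : q`_0 != 0.
    by apply: contra_neq q0 => q00; rewrite (linE q q2) q1 q00 scale0r addr0.
  have p1 : p`_1 = 0.
    by move/eqP: det0; rewrite q1 mulr0 mulf_eq0 (negPf q00) orbF => /eqP.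
  apply: (const p`_0 _ q00); rewrite (linE p p2) (linE q q2) p1 q1 !scale0r !add0r.
  by rewrite -!mul_polyC -!polyCM !coefC !eqxx mulrC.
apply: (const p`_1 _ q1); rewrite {1}(linE p p2) {2}(linE q q2).
rewrite !scalerDr !scalerA -!mul_polyC -!polyCM [q`_1 * p`_0]mulrC -det0.
by rewrite [p`_1 * q`_1]mulrC.
Qed.

End Isomorphism.

(** * Affine and inversion normal forms of fractional linear maps *)

Section FieldIdentities.
Variable K : fieldType.
Implicit Types b c t u v w : K.

Lemma affine_sub b c t u v : b + c * (t - u) - (b + c * (v - u)) = c * (t - v).
Proof. by ring. Qed.

Lemma affineK b c t u : c != 0 -> u + c^-1 * ((b + c * (t - u)) - b) = t.
Proof. by move=> c0; rewrite [b + _]addrC addrK mulKf // addrC subrK. Qed.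

(** For [w] different from [u], the condition on [c] says that b + c/(t - u) takes the value [v] at
    [w]; subtracting [v] therefore leaves a zero at [w] and a pole at [u]. *)
Lemma inversion_sub b c t u v w : t - u != 0 -> c = (v - b) * (w - u) ->
  b + c / (t - u) - v = (b - v) * ((t - w) / (t - u)).
Proof. by move=> tu ->; field. Qed.

Lemma inversionK b c t u : c != 0 -> u + c / (b + c / (t - u) - b) = t.
Proof.
move=> c0; rewrite [b + _]addrC addrK invf_div mulrC divfK //.
by rewrite addrC subrK.
Qed.

Lemma moebius_affine b c t v : v != 0 ->
  (b * t + c) / (0 * t + v) = c / v + b / v * (t - 0).
Proof. by move=> v0; field. Qed.

Lemma moebius_inversion b c t u v : u != 0 -> u * t + v != 0 ->
  (b * t + c) / (u * t + v) =
    b / u + (c * u - b * v) / u ^+ 2 / (t - (- (v / u))).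
Proof.
move=> u0 uv0; have e : t - - (v / u) = (u * t + v) / u by field.
by rewrite e; field; rewrite uv0 u0.
Qed.

End FieldIdentities.

Section NormalForms.
Variable F : closedFieldType.
Implicit Types (b c : F) (f : {lrmorphism ratfun F -> ratfun F}).
Local Notation t := (rvar F).

(** The two shapes of f(t): pole at infinity, or pole at [b'] with value [b] at infinity. In the
    affine shape f(t) takes the value [b] at the base point [b'], so a_1 and a'_1 can serve as [b]
    and [b']. *)
Definition affine_at f b c b' := f t = rconst b + rconst c * (t - rconst b').
Definition inversion_at f b c b' := f t = rconst b + rconst c / (t - rconst b').

Lemma ratfun_morph_sub f c : f (t - rconst c) = f t - rconst c.
Proof. by rewrite (rmorphB f) /= lrmorph_rconst. Qed.

Lemma affine_linear f b c b' u v : affine_at f b c b' ->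
  u - b = c * (v - b') -> f (t - rconst u) = rconst c * (t - rconst v).
Proof.
move=> fE uv; have -> : u = b + c * (v - b') by rewrite -uv addrC subrK.
rewrite ratfun_morph_sub fE rmorphD rmorphM rmorphB; exact: affine_sub.
Qed.

Lemma inversion_center f b c b' : inversion_at f b c b' ->
  f (t - rconst b) = rconst c / (t - rconst b').
Proof. by move=> fE; rewrite ratfun_morph_sub fE addrC addKr. Qed.

Lemma inversion_linear f b c b' u v : inversion_at f b c b' ->
    (u - b) * (v - b') = c ->
  f (t - rconst u) = rconst (b - u) * ((t - rconst v) / (t - rconst b')).
Proof.
move=> fE uv; rewrite ratfun_morph_sub fE [rconst (b - u)]rmorphB.
by apply: inversion_sub; rewrite ?rvar_sub_neq0 // -!rmorphB -rmorphM uv.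
Qed.

Lemma exists_affine b c b' : c != 0 -> exists f, affine_at f b c b'.
Proof.
move=> c0; apply: exists_subst => d; apply/eqP => e.
have /eqP[] := nonconst_rvar (b' + c^-1 * (d - b)).
rewrite rmorphD rmorphM (fmorphV (@rconst F)) rmorphB /= -e.
by rewrite affineK // rconst_eq0.
Qed.

Lemma exists_inversion b c b' : c != 0 -> exists f, inversion_at f b c b'.
Proof.
move=> c0; apply: exists_subst => d; apply/eqP => e.
have /eqP[] := nonconst_rvar (b' + c / (d - b)).
rewrite rmorphD rmorphM (fmorphV (@rconst F)) rmorphB /= -e.
by rewrite inversionK // rconst_eq0.
Qed.

Lemma affine_atK f g b c b' : c != 0 ->
  affine_at f b c b' -> affine_at g b' c^-1 b -> f (g t) = t.
Proof.
move=> c0 fE ->; rewrite rmorphD rmorphM /= !lrmorph_rconst.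
rewrite (fmorphV (@rconst F)) ratfun_morph_sub fE.
by rewrite affineK // rconst_eq0.
Qed.

(** The relation (y - b)(t - b') = c is symmetric in the two factors, so the inverse map swaps [b]
    and [b'] and keeps [c]. *)
Lemma inversion_atK f g b c b' : c != 0 ->
  inversion_at f b c b' -> inversion_at g b' c b -> f (g t) = t.
Proof.
move=> c0 fE ->; rewrite rmorphD rmorphM (fmorphV f) /= !lrmorph_rconst.
by rewrite ratfun_morph_sub fE inversionK // rconst_eq0.
Qed.

Lemma moebius_normal_form f p q r s : p * s - q * r != 0 ->
    f t = (p *: t + rconst q) / (r *: t + rconst s) ->
  exists b c b', c != 0 /\ (affine_at f b c b' \/ inversion_at f b c b').
Proof.
rewrite !ratfun_scaleE; have [->|r0] := eqVneq r 0.
  rewrite mulr0 subr0 mulf_eq0 negb_or => /andP[p0 s0] fE.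
  exists (q / s), (p / s), 0; rewrite mulf_neq0 ?invr_eq0 //; split=> //; left.
  rewrite /affine_at fE !rmorphM (fmorphV (@rconst F)) !rmorph0.
  by apply: moebius_affine; rewrite rconst_eq0.
(* These are the value at infinity, minus the determinant over r^2, and the pole. *)
move=> det0 fE; exists (p / r), ((q * r - p * s) / r ^+ 2), (- (s / r)).
split; first by rewrite mulf_neq0 ?invr_eq0 ?expf_neq0 // -opprB oppr_eq0.
right; rewrite /inversion_at fE rmorphN !rmorphM !(fmorphV (@rconst F)).
rewrite rmorphXn rmorphB !rmorphM.
apply: moebius_inversion; first by rewrite rconst_eq0.
have : ratpoly (r *: 'X + s%:P) != 0.
  rewrite ratpoly_eq0; apply/eqP => /(congr1 (coefp 1)).
  by rewrite /= !coefE /= mulr1 addr0; apply/eqP.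
by rewrite rmorphD -mul_polyC rmorphM.
Qed.

Variables (n m : nat) (a : 'I_n -> F) (a' : 'I_m -> F).

Lemma affine_Ra f b c b' : c != 0 -> affine_at f b c b' ->
    (forall i, exists j, a i - b = c * (a' j - b')) ->
  forall x, x \in Ra_mem a -> f x \in Ra_mem a'.
Proof.
move=> c0 fE aa'; apply: lrmorph_Ra_mem => [|i].
  by rewrite fE rpredD ?rpredM ?rconst_Ra ?rvar_sub_Ra.
have [j /(affine_linear fE)->] := aa' i.
by rewrite invfM -(fmorphV (@rconst F)) rpredM ?rconst_Ra ?rvar_sub_inv_Ra.
Qed.

(** If a_i = b, then t - a_i goes to c/(t - b'), whose inverse is linear; otherwise it goes to a
    constant times a quotient of two linear units of R_{a'}. *)
Lemma inversion_Ra f b c j0 : c != 0 -> inversion_at f b c (a' j0) ->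
    (forall i, a i != b -> exists j, (a i - b) * (a' j - a' j0) = c) ->
  forall x, x \in Ra_mem a -> f x \in Ra_mem a'.
Proof.
move=> c0 fE aa'; apply: lrmorph_Ra_mem => [|i].
  by rewrite fE rpredD ?rpredM ?rconst_Ra ?rvar_sub_inv_Ra.
have [->|/aa'[j /(inversion_linear fE)->]] := eqVneq (a i) b.
  rewrite (inversion_center fE) invf_div -(fmorphV (@rconst F)).
  by rewrite rpredM ?rconst_Ra ?rvar_sub_Ra.
rewrite invfM invf_div -(fmorphV (@rconst F)).
by rewrite !rpredM ?rconst_Ra ?rvar_sub_Ra ?rvar_sub_inv_Ra.
Qed.

(** Let z be the point where f(t) takes the value a_i. The image of 1/(t - a_i) has a pole at z and
    lies in R_{a'}, so z is one of the a'_j. *)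
Lemma affine_matching f b c b' : c != 0 -> affine_at f b c b' ->
    (forall x, x \in Ra_mem a -> f x \in Ra_mem a') ->
  forall i, exists j, a i - b = c * (a' j - b').
Proof.
move=> c0 fE fR i; pose z := b' + c^-1 * (a i - b).
have zE : a i - b = c * (z - b') by rewrite /z [b' + _]addrC addrK mulVKf.
have := fR _ (rvar_sub_inv_Ra a i).
rewrite (fmorphV f) /= (affine_linear fE zE) => h.
suff [j ajz] : exists j, a' j = z by exists j; rewrite ajz.
apply: rvar_sub_inv_RaP; rewrite -[_^-1](mulVKf (x := rconst c)) ?rconst_eq0 //.
by rewrite -invfM rpredM ?rconst_Ra.
Qed.

Lemma inversion_pole f b c b' : c != 0 -> inversion_at f b c b' ->
  f t \in Ra_mem a' -> exists j, a' j = b'.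
Proof.
move=> c0 fE fR; apply: rvar_sub_inv_RaP.
have -> : (t - rconst b')^-1 = rconst c^-1 * (f t - rconst b).
  by rewrite fE [rconst b + _]addrC addrK (fmorphV (@rconst F)) mulKf ?rconst_eq0.
by rewrite rpredM ?rpredB ?rconst_Ra.
Qed.

(** As in the affine case, with z the point where f(t) equals a_i; it is finite because a_i differs
    from the value [b] at infinity, and differs from [b'] because [c] is nonzero. *)
Lemma inversion_matching f b c b' : c != 0 -> inversion_at f b c b' ->
    (forall x, x \in Ra_mem a -> f x \in Ra_mem a') ->
  forall i, a i != b -> exists j, (a i - b) * (a' j - b') = c.
Proof.
move=> c0 fE fR i aib; have ab0 : a i - b != 0 by rewrite subr_eq0.
pose z := b' + (a i - b)^-1 * c.
have zE : (a i - b) * (z - b') = c by rewrite /z [b' + _]addrC addrK mulVKf.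
suff [j ajz] : exists j, a' j = z by exists j; rewrite ajz.
have := fR _ (rvar_sub_inv_Ra a i).
rewrite (fmorphV f) /= (inversion_linear fE zE) invfM invf_div => h.
apply: (@Ra_pole _ _ a' z ('X - b'%:P) ('X - z%:P)).
- by rewrite polyXsubC_eq0.
- by rewrite hornerXsubC subrr.
- by rewrite hornerXsubC; apply: contra_neq c0 => e; rewrite -zE e mulr0.
have ba0 : rconst (b - a i) != 0 by rewrite rconst_eq0 -opprB oppr_eq0.
by rewrite !ratpolyXsubC -[_ / _](mulVKf ba0) rpredM ?rconst_Ra.
Qed.

End NormalForms.

(** * Matching of the two point sets, and isomorphisms obtained from substitutions *)

Section Classification.
Variables (F : closedFieldType) (n m : nat).
Variables (a : 'I_n -> F) (a' : 'I_m -> F).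
Local Notation t := (rvar F).
Implicit Types (b c u v : F) (f g : {lrmorphism ratfun F -> ratfun F}).

Lemma ratfun_lrmorphK f g : f (g t) = t -> cancel g f.
Proof.
move=> fgt; pose h : {lrmorphism ratfun F -> ratfun F} := f \o g.
pose h1 : {lrmorphism ratfun F -> ratfun F} := idfun.
by apply: (ratfun_lrmorph_ext (f := h) (g := h1)).
Qed.

Lemma affine_linear_expz f b c b' u v (k : int) : affine_at f b c b' ->
  u - b = c * (v - b') ->
  f ((t - rconst u) ^ k) = (c ^ k) *: (t - rconst v) ^ k.
Proof.
move=> fE uv; rewrite (fmorphXz f) /= (affine_linear fE uv) expfzMl.
by rewrite ratfun_scaleE (fmorphXz (@rconst F)).
Qed.

Lemma inversion_center_expz f b c b' (k : int) : inversion_at f b c b' ->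
  f ((t - rconst b) ^ k) = rconst (c ^ k) / (t - rconst b') ^ k.
Proof.
move=> fE; rewrite (fmorphXz f) /= (inversion_center fE) expfzMl.
by rewrite (fmorphXz (@rconst F)) exprz_inv invr_expz.
Qed.

Lemma inversion_linear_expz f b c b' u v (k : int) : inversion_at f b c b' ->
    (u - b) * (v - b') = c ->
  f ((t - rconst u) ^ k) =
    ((b - u) ^ k) *: (t - rconst v) ^ k / (t - rconst b') ^ k.
Proof.
move=> fE uv; rewrite (fmorphXz f) /= (inversion_linear fE uv) !expfzMl.
by rewrite ratfun_scaleE (fmorphXz (@rconst F)) exprz_inv invr_expz mulrA.
Qed.

(** Two substitutions that are mutually inverse on t are inverse on F(t), and they restrict to the
    subalgebras they preserve. *)
Lemma Ra_iso_of_subst f g : f (g t) = t -> g (f t) = t ->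
    (forall x, x \in Ra_mem a -> f x \in Ra_mem a') ->
    (forall x, x \in Ra_mem a' -> g x \in Ra_mem a) ->
  exists phi : {lrmorphism Ra a -> Ra a'},
    bijective phi /\ forall x, Ra_val (phi x) = f (Ra_val x).
Proof.
move=> fgt gft fR gR.
pose h (x : Ra a) : Ra a' := MkRa (fR _ (Ra_valP x)).
have hadd : zmod_morphism h by move=> x y; apply: val_inj; apply: (rmorphB f).
have hmul : monoid_morphism h.
  split=> [|x y]; apply: val_inj; first exact: (rmorph1 f).
  exact: (rmorphM f (Ra_val x) (Ra_val y)).
have hscal : scalable h.
  by move=> c x; apply: val_inj; apply: (linearZ_LR f c (Ra_val x)).
pose hA := GRing.isZmodMorphism.Build (Ra a) (Ra a') h hadd.
pose hM := GRing.isMonoidMorphism.Build (Ra a) (Ra a') h hmul.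
pose hZ := GRing.isScalable.Build F (Ra a) (Ra a') *:%R h hscal.
exists (HB.pack h hA hM hZ : {lrmorphism Ra a -> Ra a'}); split=> //=.
exists (fun y : Ra a' => MkRa (gR _ (Ra_valP y)) : Ra a) => x.
  by apply: val_inj; apply: (ratfun_lrmorphK gft).
by apply: val_inj; apply: (ratfun_lrmorphK fgt).
Qed.

(** Since t = (t - a_i) + a_i, one formula with exponent 1 determines the morphism; this gives the
    uniqueness in [defines_iso]. *)
Lemma Ra_morph_eq (phi psi : {lrmorphism Ra a -> Ra a'}) i :
  Ra_val (phi (linpow a i 1)) = Ra_val (psi (linpow a i 1)) -> phi =1 psi.
Proof.
move=> e; pose f : {lrmorphism Ra a -> ratfun F} := @Ra_val _ _ a' \o phi.
pose g : {lrmorphism Ra a -> ratfun F} := @Ra_val _ _ a' \o psi.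
have fg : f (Ra_var a) = g (Ra_var a).
  have -> : Ra_var a = linpow a i 1 + (a i)%:A.
    by apply: val_inj; rewrite /= expr1z -rconstE subrK.
  have fc : f (a i)%:A = (a i)%:A by apply: (rmorph_alg f).
  have gc : g (a i)%:A = (a i)%:A by apply: (rmorph_alg g).
  apply: etrans (rmorphD f _ _) _; apply: etrans (esym (rmorphD g _ _)).
  by rewrite [X in _ + X]fc [X in _ = _ + X]gc; congr (_ + _); apply: e.
by move=> x; apply: val_inj; apply: (Ra_lrmorph_ext fg).
Qed.

(** [sigma] sends i to the index of the point where phi(t) equals a_i. In the inversion case the
    value [b] is taken at infinity, and an index with a_i = b is sent instead to the index [j0] of
    the pole. *)
Lemma Ra_iso_matching (phi : {lrmorphism Ra a -> Ra a'})
    (psi : {lrmorphism Ra a' -> Ra a}) :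
    injective a -> cancel phi psi -> cancel psi phi ->
  exists f b c b' (sigma : 'I_n -> 'I_m),
    [/\ forall x, f (Ra_val x) = Ra_val (phi x), c != 0, injective sigma
      & (affine_at f b c b' /\
           forall i, a i - b = c * (a' (sigma i) - b')) \/
        (inversion_at f b c b' /\ exists2 j0, a' j0 = b' &
           forall i, if a i == b then sigma i = j0
                     else (a i - b) * (a' (sigma i) - b') = c)].
Proof.
move=> aI phiK psiK; have [f fE] := Ra_morph_extend (can_inj phiK).
have fR x : x \in Ra_mem a -> f x \in Ra_mem a'.
  by move=> xR; rewrite (fE (MkRa xR)) Ra_valP.
have [p [q [r [s [det0]]]]] := Ra_iso_moebius phiK psiK.
rewrite -fE => /(moebius_normal_form det0)[b [c [b' [c0 [aff|inv]]]]].
  have /choice[sigma sE] := affine_matching c0 aff fR.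
  exists f, b, c, b', sigma; split=> //; last by left.
  by move=> i j ij; apply/aI/(addIr (- b)); rewrite !sE ij.
have [j0 jE] := inversion_pole c0 inv (fR _ (rvar_Ra a)).
have /choice[sigma sE] : forall i, exists j,
    if a i == b then j = j0 else (a i - b) * (a' j - b') = c.
  move=> i; have [_|] := eqVneq; first by exists j0.
  exact: inversion_matching c0 inv fR i.
exists f, b, c, b', sigma; split=> //; last by right; split=> //; exists j0.
(* Any other index sent to the pole would force [c = 0]. *)
have sj0 i : a i != b -> sigma i != j0.
  move=> aib; apply: contra_neq c0 => sij; have := sE i.
  by rewrite (negPf aib) sij jE subrr mulr0.
move=> i j ij; have := sE i; have := sE j.
have [aj|aj] := eqVneq (a j) b; have [ai|ai] := eqVneq (a i) b.
- by move=> _ _; apply: aI; rewrite ai aj.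
- by move=> sj; rewrite -ij in sj; have := sj0 _ ai; rewrite sj eqxx.
- by move=> _ si; rewrite ij in si; have := sj0 _ aj; rewrite si eqxx.
rewrite ij => <- /mulIf e; apply: aI; apply: (addIr (- b)); apply: e.
by apply: contra_neq c0 => e; have := sE j; rewrite (negPf aj) e mulr0.
Qed.

End Classification.

Lemma Ra_iso_leq (F : closedFieldType) (n m : nat) (a : 'I_n -> F)
    (a' : 'I_m -> F) (phi : {lrmorphism Ra a -> Ra a'})
    (psi : {lrmorphism Ra a' -> Ra a}) :
  injective a -> cancel phi psi -> cancel psi phi -> (n <= m)%N.
Proof.
move=> aI phiK psiK.
have [f [b [c [b' [sigma [_ _ sI _]]]]]] := Ra_iso_matching aI phiK psiK.
by have := leq_card sigma sI; rewrite !card_ord.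
Qed.

(** * The two cases and their converses *)

Section MainCases.
Variables (F : closedFieldType) (n m : nat) (i1 : 'I_n).
Variables (a : 'I_n -> F) (a' : 'I_m -> F).
Hypotheses (aI : injective a) (a'I : injective a').

Lemma Ra_iso_fractional_linear (phi : {lrmorphism Ra a -> Ra a'})
    (psi : {lrmorphism Ra a' -> Ra a}) :
  cancel phi psi -> cancel psi phi -> fractional_linear phi.
Proof.
move=> phiK psiK; have [f fE] := Ra_morph_extend (can_inj phiK).
have [g gE] := Ra_morph_extend (can_inj psiK).
exists f; split=> //; last first.
  by rewrite (fE (Ra_var a)); apply: Ra_iso_moebius psiK.
exists g; apply: ratfun_lrmorphK.
  by rewrite (fE (Ra_var a)) gE; apply: congr1 (phiK _).
by rewrite (gE (Ra_var a')) fE; apply: congr1 (psiK _).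
Qed.

(** Applying [Ra_iso_leq] to the inverse gives m <= n, so the injective matching [sigma] is a
    bijection. An affine phi(t) gives (a), an inversion gives (b). *)
Lemma Ra_iso_cases (phi : {lrmorphism Ra a -> Ra a'})
    (psi : {lrmorphism Ra a' -> Ra a}) :
    cancel phi psi -> cancel psi phi ->
  (exists (c : F) (sigma : 'I_n -> 'I_m),
     [/\ c != 0, bijective sigma, caseA_cond i1 a a' sigma c
       & caseA_formula sigma c phi])
  \/
  (exists (c : F) (tau : 'I_n -> 'I_n) (sigma : 'I_n -> 'I_m),
     [/\ c != 0, bijective tau, bijective sigma,
         caseB_cond i1 a a' tau sigma c & caseB_formula i1 tau sigma c phi]).
Proof.
move=> phiK psiK; have mn := Ra_iso_leq a'I psiK phiK.
have [f [b [c [b' [sigma [fE c0 sI fcase]]]]]] := Ra_iso_matching aI phiK psiK.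
have sB : bijective sigma by apply: inj_card_bij sI _; rewrite !card_ord.
case: fcase => [[aff sE]|[inv [j0 jE sE]]].
  left; exists c, sigma; split=> // [i|k i].
    have -> : a i - a i1 = (a i - b) - (a i1 - b) by rewrite opprB subrKA.
    by rewrite !sE -mulrBr opprB subrKA.
  by rewrite -fE; apply: affine_linear_expz aff (sE i).
(* The index matched with the pole must carry the value at infinity, a_{i0} = b; otherwise the
   matching relation would read 0 = c. *)
have [i0 i0E] : exists i0, sigma i0 = j0.
  by have [s _ sK] := sB; exists (s j0).
have ai0 : a i0 = b.
  have := sE i0; case: eqP => // _; rewrite i0E jE subrr mulr0 => e.
  by rewrite e eqxx in c0.
(* The transposition moves this special index to position 1, and both families are reordered by
   it. *)
pose tau := tperm i1 i0.
have tau1 : tau i1 = i0 by rewrite tpermL.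
have tauN i : i != i1 -> (a (tau i) - b) * (a' (sigma (tau i)) - b') = c.
  move=> ii1; have := sE (tau i); case: eqP => // e.
  by case/eqP: ii1; apply/(@perm_inj _ tau)/aI; rewrite e tau1.
right; exists c, tau, (sigma \o tau); split=> //.
- by apply: injF_bij; apply: perm_inj.
- by apply: bij_comp => //; apply: injF_bij; apply: perm_inj.
- by move=> i /tauN; rewrite /= tau1 i0E ai0 jE.
move=> k; rewrite /= tau1 i0E jE ai0; split=> [|i /tauN e].
  rewrite -fE; have := inversion_center_expz k inv; rewrite -ai0 => <-; congr (f _).
by rewrite -fE; apply: inversion_linear_expz inv e.
Qed.

(** The isomorphism is the restriction of the affine substitution with base points a_1 and a'_{sigma
    1}; its inverse has slope 1/c. *)
Lemma caseA_defines_iso (c : F) (sigma : 'I_n -> 'I_m) :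
    c != 0 -> bijective sigma -> caseA_cond i1 a a' sigma c ->
  defines_iso (@caseA_formula _ n m a a' sigma c).
Proof.
move=> c0 [s sK s'K] cond; have c'0 : c^-1 != 0 by rewrite invr_eq0.
have [f fE] := exists_affine (a i1) (a' (sigma i1)) c0.
have [g gE] := exists_affine (a' (sigma i1)) (a i1) c'0.
have fgt := affine_atK c0 fE gE.
have gft : g (f (rvar F)) = rvar F.
  by apply: (affine_atK c'0 gE); rewrite invrK.
have [|j|phi [phiB phiE]] := Ra_iso_of_subst (a := a) (a' := a') fgt gft.
- by apply: (affine_Ra c0 fE) => i; exists (sigma i).
- apply: (affine_Ra c'0 gE) => {}j; exists (s j).
  by rewrite cond s'K mulKf.
have phiP : caseA_formula sigma c phi.
  by move=> k i; rewrite phiE; apply: affine_linear_expz fE (cond i).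
exists phi; split=> // psi psiP; apply: (Ra_morph_eq (i := i1)).
by rewrite phiP psiP.
Qed.

(** The isomorphism is the restriction of the inversion with value a_{tau 1} at infinity and pole
    a'_{sigma 1}; its inverse is the inversion with these two points exchanged. *)
Lemma caseB_defines_iso (c : F) (tau : 'I_n -> 'I_n) (sigma : 'I_n -> 'I_m) :
    c != 0 -> bijective tau -> bijective sigma ->
    caseB_cond i1 a a' tau sigma c ->
  defines_iso (@caseB_formula _ n m i1 a a' tau sigma c).
Proof.
move=> c0 [u uK u'K] [s sK s'K] cond.
have [f fE] := exists_inversion (a (tau i1)) (a' (sigma i1)) c0.
have [g gE] := exists_inversion (a' (sigma i1)) (a (tau i1)) c0.
have fgt := inversion_atK c0 fE gE.
have gft := inversion_atK c0 gE fE.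
have [|j|phi [phiB phiE]] := Ra_iso_of_subst (a := a) (a' := a') fgt gft.
- apply: (inversion_Ra c0 fE) => i ai; exists (sigma (u i)).
  rewrite -(cond (u i)) ?u'K //; apply: contra_neq ai => <-; by rewrite u'K.
- apply: (inversion_Ra c0 gE) => {}j aj; exists (tau (s j)).
  rewrite -(cond (s j)) ?s'K 1?mulrC //; apply: contra_neq aj => <-; by rewrite s'K.
have phiP : caseB_formula i1 tau sigma c phi.
  move=> k; split=> [|i ii1]; rewrite phiE; first exact: inversion_center_expz fE.
  exact: inversion_linear_expz fE (cond i ii1).
exists phi; split=> // psi psiP; apply: (Ra_morph_eq (i := tau i1)).
by rewrite (phiP 1).1 (psiP 1).1.
Qed.

End MainCases.

Theorem theorem4 (R : realType) (n m : nat) (hn : (0 < n)%N) (hm : (0 < m)%N)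
    (a : 'I_n -> R[i]) (a' : 'I_m -> R[i])
    (ha : injective a) (ha' : injective a') :
  let i1 : 'I_n := Ordinal hn in
  (forall phi : {lrmorphism Ra a -> Ra a'}, bijective phi ->
     [/\ m = n,
         fractional_linear phi
       & (exists (c : R[i]) (sigma : 'I_n -> 'I_m),
            [/\ c != 0, bijective sigma, caseA_cond i1 a a' sigma c
              & caseA_formula sigma c phi])
         \/
         (exists (c : R[i]) (tau : 'I_n -> 'I_n) (sigma : 'I_n -> 'I_m),
            [/\ c != 0, bijective tau, bijective sigma,
                caseB_cond i1 a a' tau sigma c
              & caseB_formula i1 tau sigma c phi])])
  /\
  (m = n ->
     (forall (c : R[i]) (sigma : 'I_n -> 'I_m),
        c != 0 -> bijective sigma -> caseA_cond i1 a a' sigma c ->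
        defines_iso (@caseA_formula _ n m a a' sigma c))
     /\
     (forall (c : R[i]) (tau : 'I_n -> 'I_n) (sigma : 'I_n -> 'I_m),
        c != 0 -> bijective tau -> bijective sigma ->
        caseB_cond i1 a a' tau sigma c ->
        defines_iso (@caseB_formula _ n m i1 a a' tau sigma c))).
Proof.
move=> i1; split=> [phi /lrmorph_inverse[psi [phiK psiK]]|_].
  split.
  - apply/eqP; rewrite eqn_leq (Ra_iso_leq ha phiK psiK).
    by rewrite (Ra_iso_leq ha' psiK phiK).
  - exact: Ra_iso_fractional_linear phiK psiK.
  - exact: Ra_iso_cases ha ha' phi psi phiK psiK.
split=> [c sigma|c tau sigma]; first exact: caseA_defines_iso.
exact: caseB_defines_iso.
Qed.
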